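(* (Linear Bellman operator.) Let $\lambda>0$ and consider the synchronized soft-policy risk-sensitive stochastic optimal control problem $$\min_{\underline{\pi}}\min_{\underline{\tau}}\ \mathbb{E}_{p_{(\underline{\pi},\underline{\tau})}}\Bigl[\underline{c}_T+\tfrac1\lambda\sum_{t=0}^{T-1}\log\tfrac{\pi_t}{\rho_t}+\tfrac1\lambda\sum_{t=0}^{T-1}\log\tfrac{\tau_t}{\iota_t}\Bigr]$$ with optimal value functions $V_t$. Then the desirability $z_t:=e^{-\lambda V_t}$ satisfies, with $r_t:=e^{-\lambda c_t}$, the linear Bellman equation $$z_t=\mathbb{E}_{\rho_t}\bigl[r_t\,\mathbb{E}_{\iota_t}[z_{t+1}]\bigr],\qquad t=T-1,\dots,0.$$
   Context: Setting: a discrete-time controlled stochastic system with finite horizon $T$, states $x_t$, actions $u_t$, and trajectories $\underline{\xi}_T=(x_0,u_0,\dots,x_{T-1},u_{T-1},x_T)$. A policy sequence $\underline{\pi}=(\pi_0,\dots,\pi_{T-1})$ consists of conditional distributions $\pi_t(u_t\mid x_t)$; a transition-kernel sequence $\underline{\tau}=(\tau_0,\dots,\tau_{T-1})$ consists of conditional distributions $\tau_t(x_{t+1}\mid x_t,u_t)$. They induce the trajectory distribution $p_{(\underline{\pi},\underline{\tau})}(\underline{\xi}_T)=p(x_0)\prod_{t=0}^{T-1}\pi_t(u_t\mid x_t)\,\tau_t(x_{t+1}\mid x_t,u_t)$, with a fixed initial state distribution $p(x_0)$. The fixed baseline consists of a reference policy sequence $\underline{\rho}=(\rho_t)$ and the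 system's true transition kernels $\underline{\iota}=(\iota_t)$; decision variables are required to be absolutely continuous with respect to the baseline ($\pi_t\ll\rho_t$, $\tau_t\ll\iota_t$). Costs: $\underline{c}_T(\underline{\xi}_T)=\sum_{t=0}^{T-1}c_t(x_t,u_t)+c_T(x_T)$ with $c_t\ge 0$ and $c_T\ge 0$. Standing assumption: all trajectory expectations and risk operators that appear are finite for the policies and transitions considered. Notation: $\mathbb{D}^{\mu}_{\sigma}=\mathbb{E}_\mu[\log\frac{\mu}{\sigma}]$ is the Kullback-Leibler divergence, taken conditionally for kernels. $\mathbb{E}_{\rho_t}$ denotes expectation over $u_t\sim\rho_t(\cdot\mid x_t)$ and $\mathbb{E}_{\iota_t}$ expectation over $x_{t+1}\sim\iota_t(\cdot\mid x_t,u_t)$. $r_t$ is a function of $(x_t,u_t)$; $V_t$, $z_t$ are functions of $x_t$. Optimal value function: $V_T=c_T$ and, for $t<T$, $V_t(x_t)$ is the minimum over $(\pi_k,\tau_k)_{k=t}^{T-1}$ of $\mathbb{E}\bigl[c_T+\sum_{k=t}^{T-1}\bigl(c_k+\frac1\lambda\mathbb{D}^{\pi_k}_{\rho_k}+\frac1\lambda\mathbb{D}^{\tau_k}_{\iota_k}\bigr)\bigr]$ over the trajectory segment from $t$ to $T$ generated by $(\pi_k,\tau_k)_{k\ge t}$ given $x_t$. *)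

(* Defs.v *)
From HB Require Import structures.
From mathcomp Require Import all_boot all_order all_algebra.
From mathcomp Require Import all_classical all_reals all_analysis.
From mathcomp Require Import measurable_realfun.

Set Implicit Arguments.
Unset Strict Implicit.
Unset Printing Implicit Defensive.

Import Order.TTheory GRing.Theory Num.Theory.
Import numFieldNormedType.Exports.
Import KCOMP_FINITE_KERNEL.

Local Open Scope classical_set_scope.
Local Open Scope ring_scope.
Local Open Scope ereal_scope.

(* The conditional distribution k(. | x), packed as a probability measure. *)
Section kernel_at.
Context d d' (X : measurableType d) (Y : measurableType d') (R : realType).
Variables (k : R.-pker X ~> Y) (x : X).

Definition kernel_at : set Y -> \bar R := k x.

HB.instance Definition _ := Measure.copy kernel_at (k x).

Let kernel_atT : kernel_at [set: Y] = 1.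
Proof. exact: prob_kernel. Qed.

HB.instance Definition _ :=
  Measure_isProbability.Build _ _ _ kernel_at kernel_atT.

End kernel_at.

(* Meaningful when P `<< Q, which is how it is used below: the Radon-Nikodym
   derivative of the library is a junk value otherwise. *)
Definition KL d (Y : measurableType d) (R : realType) (P Q : probability Y R)
    : \bar R :=
  \int[P]_y lne (Radon_Nikodym (charge_of_finite_measure P) Q y).

Section condKL.
Context d d' (X : measurableType d) (Y : measurableType d') (R : realType).

Definition condKL (k l : R.-pker X ~> Y) (x : X) : \bar R :=
  KL (kernel_at k x) (kernel_at l x).

(* The measurability of the conditional divergence, without which its
   expectation along a trajectory has no meaning, is automatic when Y is
   standard Borel (or just countably generated). *)
Definition ac_kernel (k l : R.-pker X ~> Y) : Prop :=
  (forall x, k x `<< l x) /\ measurable_fun [set: X] (condKL k l).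

End condKL.

Lemma mkcomp_prob d1 d2 d3 (X : measurableType d1) (Y : measurableType d2)
    (Z : measurableType d3) (R : realType) (k : R.-ker X ~> Y)
    (l : R.-ker (X * Y) ~> Z) :
  (forall x, k x [set: Y] = 1) -> (forall w, l w [set: Z] = 1) ->
  forall x, mkcomp k l x [set: Z] = 1.
Proof.
move=> k1 l1 x; rewrite /mkcomp/= /kcomp.
by under eq_integral do rewrite l1; rewrite integral_cst// mul1e k1.
Qed.

Section trajectories.
Context dX dU (X : measurableType dX) (U : measurableType dU) (R : realType).

(* Trajectory segments of n steps: ((x_t,u_t), ..., (x_(t+n-1),u_(t+n-1)))
   together with the final state x_(t+n). *)
Definition traj_cons n (w : (X * U * X) * (n.-tuple (X * U) * X))
    : n.+1.-tuple (X * U) * X :=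
  ([the n.+1.-tuple (X * U) of w.1.1 :: w.2.1], w.2.2).

Lemma measurable_traj_cons n : measurable_fun [set: _] (@traj_cons n).
Proof.
apply/measurable_fun_pairP; split; last first.
  exact: measurableT_comp measurable_snd measurable_snd.
apply: measurable_cons.
- exact: measurableT_comp measurable_fst measurable_fst.
- exact: measurableT_comp measurable_fst measurable_snd.
Qed.

Definition traj_nil (x : X) : 0.-tuple (X * U) * X := ([tuple], x).

Lemma measurable_traj_nil : measurable_fun [set: X] traj_nil.
Proof.
apply/measurable_fun_pairP; split; last exact: measurable_id.
exact: (@measurable_cst _ _ X (0.-tuple (X * U)%type) setT [tuple]).
Qed.

Section snd_kernel.
Context d (Z : measurableType d).
Variable K : R.-pker X ~> Z.

Definition snd_kernel (w : X * U * X) : {measure set Z -> \bar R} := K w.2.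

Let measurable_snd_kernel A : measurable A ->
  measurable_fun [set: X * U * X] (snd_kernel ^~ A).
Proof.
by move=> mA; exact: measurableT_comp (measurable_kernel K _ mA) measurable_snd.
Qed.

HB.instance Definition _ :=
  isKernel.Build _ _ _ _ _ snd_kernel measurable_snd_kernel.

Let snd_kernel_prob w : snd_kernel w [set: Z] = 1.
Proof. exact: prob_kernel. Qed.

HB.instance Definition _ :=
  Kernel_isProbability.Build _ _ _ _ _ snd_kernel snd_kernel_prob.

End snd_kernel.

(* From x: draw u ~ p(. | x), y ~ q(. | x, u), then a segment w ~ K(. | y), and
   return w with (x, u) put in front. *)
Section traj_step.
Variable n : nat.
Variables (p : R.-pker X ~> U) (q : R.-pker (X * U) ~> X).
Variable K : R.-pker X ~> (n.-tuple (X * U) * X)%type.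

Definition traj_step :
    X -> {measure set (n.+1.-tuple (X * U) * X)%type -> \bar R} :=
  mkcomp p
    (mkcomp q (mkcomp (snd_kernel K) (kdirac (@measurable_traj_cons n)))).

HB.instance Definition _ := Kernel.on traj_step.

Let traj_step_prob x : traj_step x [set: _] = 1.
Proof.
apply: mkcomp_prob => [{}x|w]; first exact: prob_kernel.
apply: mkcomp_prob => [{}w|w']; first exact: prob_kernel.
by apply: mkcomp_prob => v; exact: prob_kernel.
Qed.

HB.instance Definition _ :=
  Kernel_isProbability.Build _ _ _ _ _ traj_step traj_step_prob.

End traj_step.

Variables (pi : nat -> R.-pker X ~> U) (tau : nat -> R.-pker (X * U) ~> X).

(* The law, given x_t, of the trajectory segment of n steps which starts at
   time t. *)
Fixpoint traj_law (n t : nat) : R.-pker X ~> (n.-tuple (X * U) * X)%type :=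
  if n is m.+1 then traj_step (pi t) (tau t) (traj_law m t.+1)
  else kdirac measurable_traj_nil.

End trajectories.

Section optimal_control.
Context dX dU (X : measurableType dX) (U : measurableType dU) (R : realType).
Variables (T : nat) (lambda : R).
Variables (rho : nat -> R.-pker X ~> U) (iota : nat -> R.-pker (X * U) ~> X).
Variables (c : nat -> X * U -> R) (cT : X -> R).

Definition policies : Type :=
  ((nat -> R.-pker X ~> U) * (nat -> R.-pker (X * U) ~> X))%type.

Implicit Types p : policies.

Definition stage_cost p (k : nat) (xu : X * U) : \bar R :=
  (c k xu)%:E + lambda^-1%:E * condKL (p.1 k) (rho k) xu.1
              + lambda^-1%:E * condKL (p.2 k) (iota k) xu.

Definition segment_cost p (n t : nat) (w : n.-tuple (X * U) * X) : \bar R :=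
  (cT w.2)%:E + \sum_(i < n) stage_cost p (t + i) (tnth w.1 i).

Definition cost_to_go p (t : nat) (x : X) : \bar R :=
  \int[traj_law p.1 p.2 (T - t) t x]_w segment_cost p t w.

(* Only the components of index t <= k < T matter. *)
Definition admissible (t : nat) (x : X) : set policies :=
  [set p | [/\ forall k, (t <= k < T)%N -> ac_kernel (p.1 k) (rho k),
               forall k, (t <= k < T)%N -> ac_kernel (p.2 k) (iota k) &
               cost_to_go p t x < +oo]].

Definition optimal_value (t : nat) (x : X) : \bar R :=
  if (t < T)%N then ereal_inf [set cost_to_go p t x | p in admissible t x]
  else (cT x)%:E.

End optimal_control.

(* Main.v *)
Require Import Defs.
From HB Require Import structures.
From mathcomp Require Import all_boot all_order all_algebra.
From mathcomp Require Import all_classical all_reals all_analysis.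
From mathcomp Require Import measurable_realfun.
From mathcomp Require Import lra.

Set Implicit Arguments.
Unset Strict Implicit.
Unset Printing Implicit Defensive.

Import Order.TTheory GRing.Theory Num.Theory.

Local Open Scope classical_set_scope.
Local Open Scope ring_scope.
Local Open Scope ereal_scope.

(** The minimization over policies and transition kernels is, at each stage, an
instance of the Gibbs variational principle.  For a probability measure Q and
a cost f >= 0, put F(Q,f) = - (1/lambda) log (int exp(- lambda f) dQ).  Every
P << Q satisfies F(Q,f) <= (1/lambda) KL(P,Q) + int f dP
([free_energy_le]), and equality holds for the measure P of density
exp(lambda (F(Q,f) - f)) with respect to Q ([KL_gibbs]).

Backward in time, let [soft_value] be the cost-to-go in which each stage is
replaced by its free energy: first over the next state, with respect to iota
and the future value, then over the action, with respect to rho and the sum of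
the stage cost and the first free energy.  A trajectory law is an iterated
kernel composition, so the expected cost obeys a one-step recursion
([expected_costS]), and the variational inequality, used twice per stage,
bounds it from below by [soft_value] ([soft_value_le_expected_cost]).  The
Gibbs measures depend measurably on the state, hence form kernels; they attain
the bound at all stages simultaneously ([optimal_policies_exist]).  Therefore
the optimal value is [soft_value], the minimum is attained, and, since
exp(- lambda F(Q,f)) = int exp(- lambda f) dQ turns each minimization into a
linear integral, the desirability satisfies the linear Bellman equation
([linear_bellman_soft_value]).

Divergences and integrals may be infinite.  Since stage costs and divergences
are nonnegative, all expectations exist in [0, +oo]; the value functions are
nonnegative real-valued functions because int exp(- lambda f) dQ lies in
(0, 1]. *)

(** * Relative entropy through densities *)

Section densities.
Context d (Y : measurableType d) (R : realType).
Implicit Types (P Q : probability Y R) (g phi : Y -> R).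

(** The positive and the negative parts are compared separately, so infinite
integrals are covered. *)
Lemma le_integral_measurable (m : {measure set Y -> \bar R})
    (f1 f2 : Y -> \bar R) :
  measurable_fun [set: Y] f1 -> measurable_fun [set: Y] f2 ->
  (forall y, f1 y <= f2 y) -> \int[m]_y f1 y <= \int[m]_y f2 y.
Proof.
move=> mf1 mf2 f12; rewrite integralE [leRHS]integralE leeB//.
- apply: ge0_le_integral => //; [exact: measurable_funepos..|].
  by move=> x _; apply: (@funepos_le _ _ [set: Y]) => //; rewrite inE.
- apply: ge0_le_integral => //; [exact: measurable_funeneg..|].
  by move=> x _; apply: (@funeneg_le _ _ [set: Y]) => //; rewrite inE.
Qed.

Lemma integral_probability_cst P (r : \bar R) : \int[P]_y r = r.
Proof. by rewrite integral_cst// [X in _ * X]probability_setT mule1. Qed.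

(** A finite and everywhere nonnegative version of dP/dQ; the Radon-Nikodym
derivative of a charge is nonnegative only almost everywhere. *)
Definition is_density P Q g := [/\ forall y, (0 <= g y)%R,
  measurable_fun [set: Y] g &
  forall A, measurable A -> P A = \int[Q]_(y in A) (g y)%:E].

Lemma density_dominates P Q g : is_density P Q g -> P `<< Q.
Proof.
move=> [g0 mg Pg]; apply/null_content_dominatesP => A mA QA0.
rewrite Pg//; apply: null_set_integral => //.
by apply/measurable_funTS/measurable_EFinP.
Qed.

Lemma density_exists P Q : P `<< Q -> exists g, is_density P Q g.
Proof.
move=> PQ.
have fin := Radon_Nikodym_SigmaFinite.f_fin_num PQ.
exists (fun y => fine (Radon_Nikodym_SigmaFinite.f P Q y)); split.
- by move=> y; apply: fine_ge0; exact: Radon_Nikodym_SigmaFinite.f_ge0.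
- apply: measurableT_comp => //.
  exact: measurable_int (Radon_Nikodym_SigmaFinite.f_integrable PQ).
- move=> A mA; rewrite (Radon_Nikodym_SigmaFinite.f_integral PQ mA).
  by apply: eq_integral => y _; rewrite fineK.
Qed.

Lemma density_integrable P Q g : is_density P Q g ->
  Q.-integrable [set: Y] (EFin \o g).
Proof.
move=> [g0 mg Pg]; apply/integrableP; split; first exact/measurable_EFinP.
under eq_integral do rewrite gee0_abs ?lee_fin//.
by rewrite -Pg// probability_setT ltry.
Qed.

Lemma density_ae_eq_Radon_Nikodym P Q g : is_density P Q g ->
  ae_eq Q [set: Y] (EFin \o g) (Radon_Nikodym (charge_of_finite_measure P) Q).
Proof.
move=> Pg; have PQ := density_dominates Pg.
apply: integral_ae_eq => //; first exact: density_integrable Pg.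
move=> A _ mA; rewrite -Radon_Nikodym_integral//.
by case: Pg => _ _ /(_ _ mA).
Qed.

Lemma integral_density P Q g (f : Y -> \bar R) : is_density P Q g ->
  measurable_fun [set: Y] f -> (forall y, 0 <= f y) ->
  \int[P]_y f y = \int[Q]_y (f y * (g y)%:E).
Proof.
move=> Pg mf f0; have PQ := density_dominates Pg.
rewrite -(Radon_Nikodym_SigmaFinite.change_of_variables PQ)//.
have mRN := measurable_int _ (Radon_Nikodym_SigmaFinite.f_integrable PQ).
have [g0 mg _] := Pg.
apply: ge0_ae_eq_integral => //.
- exact: emeasurable_funM.
- by apply: emeasurable_funM => //; exact/measurable_EFinP.
- by move=> y _; rewrite mule_ge0// Radon_Nikodym_SigmaFinite.f_ge0.
- by move=> y _; rewrite mule_ge0// lee_fin.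
- apply: ae_eqe_mul2l.
  apply: (ae_eq_trans (ae_eq_Radon_Nikodym_SigmaFinite PQ measurableT)).
  exact/ae_eq_sym/density_ae_eq_Radon_Nikodym.
Qed.

Lemma density_gt0 P Q g : is_density P Q g ->
  {ae P, forall y, (0 < g y)%R}.
Proof.
move=> [g0 mg Pg].
have mN : measurable (g @^-1` [set 0%R]).
  by rewrite -[X in measurable X]setTI; exact: mg.
exists (g @^-1` [set 0%R]); split => //.
  by rewrite Pg// integral0_eq// => y /= ->.
by move=> y /= /negP; rewrite -leNgt => gy; apply/eqP; rewrite eq_le gy g0.
Qed.

Lemma measurable_lne_fin_num (f : Y -> \bar R) :
  (forall y, f y \is a fin_num) -> measurable_fun [set: Y] f ->
  measurable_fun [set: Y] (fun y => lne (f y)).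
Proof.
move=> ffin mf.
have mff : measurable_fun [set: Y] (fun y => fine (f y)).
  exact: measurableT_comp.
rewrite [X in measurable_fun _ X](_ : _ = fun y =>
    if (fine (f y) <= 0)%R then -oo else (ln (fine (f y)))%:E); last first.
  by apply/funext => y; rewrite -[f y in LHS]fineK.
apply: measurable_fun_ifT => //; first exact: measurable_fun_ler.
apply/measurable_EFinP; apply: (measurableT_comp (@measurable_ln R)) => //.
Qed.

(** Any density computes the divergence: it agrees with the Radon-Nikodym
derivative Q-almost everywhere, hence P-almost everywhere by absolute
continuity, and it is positive P-almost everywhere, where lne is a real
logarithm. *)
Lemma KL_density P Q g : is_density P Q g -> KL P Q = \int[P]_y (ln (g y))%:E.
Proof.
move=> Pg; have PQ := density_dominates Pg; have [g0 mg _] := Pg.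
apply: ae_eq_integral => //.
- apply: measurable_lne_fin_num; first by move=> y; exact: Radon_Nikodym_fin_num.
  by apply: measurable_int; exact: Radon_Nikodym_integrable.
- by apply/measurable_EFinP; exact: (measurableT_comp (@measurable_ln R)).
- have := null_dominates_ae_eq measurableT PQ (density_ae_eq_Radon_Nikodym Pg).
  have := density_gt0 Pg; apply: filterS2 => y gy /(_ I) /= <- _.
  by rewrite -lne_EFin.
Qed.

(** Gibbs' inequality.  With g = dP/dQ and q = exp(phi - ln g), the bound
1 + x <= exp x gives phi + 1 - q <= ln g pointwise, and the P-integral of q is
at most the Q-integral of exp phi, that is, at most 1. *)
Lemma integral_le_KL P Q phi : P `<< Q ->
  P.-integrable [set: Y] (EFin \o phi) ->
  \int[Q]_y (expR (phi y))%:E <= 1 ->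
  \int[P]_y (phi y)%:E <= KL P Q.
Proof.
move=> PQ iphi Qphi; have [g Pg] := density_exists PQ.
have [g0 mg _] := Pg; rewrite (KL_density Pg).
have mphi : measurable_fun [set: Y] phi.
  by apply/measurable_EFinP; exact: measurable_int iphi.
have mln : measurable_fun [set: Y] (fun y => ln (g y)).
  exact: (measurableT_comp (@measurable_ln R)).
pose q y := expR (phi y - ln (g y)).
have mq : measurable_fun [set: Y] q.
  by apply: measurableT_comp => //; exact: measurable_funB.
have q1 : \int[P]_y (q y)%:E <= 1.
  rewrite (integral_density Pg)//; [|exact/measurable_EFinP|]; last first.
    by move=> y; rewrite lee_fin expR_ge0.
  apply: le_trans Qphi; apply: ge0_le_integral => //.
  - by move=> y _; rewrite -EFinM lee_fin mulr_ge0// expR_ge0.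
  - by apply/measurable_EFinP; exact: measurable_funM.
  - by apply/measurable_EFinP; exact: measurableT_comp.
  - move=> y _; rewrite -EFinM lee_fin.
    (* where g vanishes, ln g is a default value, which the factor g cancels *)
    have := g0 y; rewrite le_eqVlt => /predU1P[<-|gy].
      by rewrite mulr0 expR_ge0.
    by rewrite /q expRD expRN lnK// mulfVK// gt_eqF.
have iq : P.-integrable [set: Y] (EFin \o q).
  apply/integrableP; split; first exact/measurable_EFinP.
  under eq_integral do rewrite /= ger0_norm ?expR_ge0//.
  exact: le_lt_trans q1 (ltry _).
have i1 : P.-integrable [set: Y] (cst 1).
  exact: (finite_measure_integrable_cst P 1 measurableT).
apply: (@le_trans _ _ (\int[P]_y ((phi y + (1 - q y))%R)%:E)); last first.
  apply: le_integral_measurable => //.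
  - apply/measurable_EFinP; apply: measurable_funD => //.
    exact: measurable_funB.
  - exact/measurable_EFinP.
  - move=> y; rewrite lee_fin.
    by have := expR_ge1Dx (phi y - ln (g y)); rewrite -/(q y); lra.
under [leRHS]eq_integral do rewrite EFinD EFinB.
rewrite integralD//; last exact: integrableB.
rewrite integralB// integral_probability_cst.
by rewrite leeDl// sube_ge0// orbT.
Qed.

Lemma KL_ge0 P Q : P `<< Q -> 0 <= KL P Q.
Proof.
move=> PQ; rewrite -(integral0 P [set: Y]).
apply: (@integral_le_KL _ _ (cst 0%R)) => //; first exact: integrable0.
under eq_integral do rewrite expR0.
by rewrite integral_probability_cst.
Qed.

End densities.

(** * The Gibbs variational principle *)

Section free_energy.
Context d (Y : measurableType d) (R : realType) (lambda : R).
Hypothesis lambda_gt0 : (0 < lambda)%R.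
Implicit Types (P Q : probability Y R) (f : Y -> R).

Definition free_energy Q f : R :=
  (- lambda^-1 * ln (fine (\int[Q]_y (expR (- (lambda * f y)))%:E)))%R.

Section fixed_cost.
Variables (Q : probability Y R) (f : Y -> R).
Hypotheses (mf : measurable_fun [set: Y] f) (f_ge0 : forall y, (0 <= f y)%R).

Let mexp : measurable_fun [set: Y] (fun y => expR (- (lambda * f y))).
Proof.
apply: measurableT_comp => //; apply: measurableT_comp => //.
exact: measurable_funM.
Qed.

Lemma partition_function_le1 : \int[Q]_y (expR (- (lambda * f y)))%:E <= 1.
Proof.
rewrite -[leRHS](integral_probability_cst Q).
apply: ge0_le_integral => //.
- exact/measurable_EFinP.
- by move=> y _; rewrite lee_fin -expR0 ler_expR oppr_le0 mulr_ge0// ltW.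
Qed.

(** A nonnegative function whose integral vanishes is null almost everywhere,
whereas the exponential never vanishes and Q has mass 1. *)
Lemma partition_function_gt0 : 0 < \int[Q]_y (expR (- (lambda * f y)))%:E.
Proof.
rewrite lt0e integral_ge0 ?andbT; last by move=> y _; rewrite lee_fin expR_ge0.
apply/negP => /eqP Z0.
have : ae_eq Q [set: Y] (fun y => (expR (- (lambda * f y)))%:E) (cst 0).
  apply/ae_eq_integral_abs => //; first exact/measurable_EFinP.
  by under eq_integral do rewrite gee0_abs ?lee_fin ?expR_ge0//.
move=> [N [mN QN0 subN]].
have : Q [set: Y] <= Q N.
  apply: le_measure; rewrite ?inE// => y _; apply: subN => /= /(_ I) [].
  by apply/eqP; rewrite gt_eqF// expR_gt0.
by rewrite QN0 [leLHS]probability_setT lee_fin ler10.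
Qed.

Lemma expR_free_energy : (expR (- (lambda * free_energy Q f)))%:E =
  \int[Q]_y (expR (- (lambda * f y)))%:E.
Proof.
have Zfin : \int[Q]_y (expR (- (lambda * f y)))%:E \is a fin_num.
  rewrite ge0_fin_numE ?(ltW partition_function_gt0)//.
  exact: le_lt_trans partition_function_le1 (ltry _).
rewrite /free_energy mulrA mulrN mulfV ?gt_eqF// mulN1r opprK.
by rewrite lnK ?fineK// posrE fine_gt0// partition_function_gt0 ltey_eq Zfin.
Qed.

Lemma free_energy_ge0 : (0 <= free_energy Q f)%R.
Proof.
have := partition_function_le1; rewrite -expR_free_energy lee_fin.
by rewrite -expR0 ler_expR oppr_le0 pmulr_rge0.
Qed.

(** The Gibbs measure exp(- lambda f) dQ / int exp(- lambda f) dQ is thus a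
probability measure. *)
Lemma gibbs_density_normalized :
  \int[Q]_y (expR (lambda * (free_energy Q f - f y)))%:E = 1.
Proof.
under eq_integral do rewrite mulrBr expRD EFinM.
rewrite ge0_integralZl_EFin ?expR_ge0//; last exact/measurable_EFinP.
by rewrite -expR_free_energy -EFinM -expRD subrr expR0.
Qed.

(** Gibbs' inequality for phi = lambda (F - f), the logarithm of the Gibbs
density, gives lambda (F - int f dP) <= KL P Q. *)
Lemma free_energy_le P : P `<< Q ->
  (free_energy Q f)%:E <= lambda^-1%:E * KL P Q + \int[P]_y (f y)%:E.
Proof.
move=> PQ; set F := free_energy Q f.
have KL0 := KL_ge0 PQ.
have If0 : 0 <= \int[P]_y (f y)%:E by apply: integral_ge0 => y _; rewrite lee_fin.
(* phi is P-integrable unless the cost is infinite, when the bound is clear *)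
have [Ify|Ify] := eqVneq (\int[P]_y (f y)%:E) +oo.
  rewrite Ify addey ?leey// gt_eqF// (lt_le_trans ltNy0)// mule_ge0//.
  by rewrite lee_fin invr_ge0 ltW.
have iff : P.-integrable [set: Y] (EFin \o f).
  apply/integrableP; split; first exact/measurable_EFinP.
  by under eq_integral do rewrite /= ger0_norm//; rewrite ltey.
have iF : P.-integrable [set: Y] (EFin \o cst F).
  exact: (finite_measure_integrable_cst P F measurableT).
have /(integral_le_KL PQ) : P.-integrable [set: Y]
    (EFin \o (fun y => lambda * (F - f y))%R).
  rewrite (_ : _ \o _ = fun y => lambda%:E * ((EFin \o cst F) \- (EFin \o f)) y)//.
  by apply: integrableZl => //; exact: integrableB.
rewrite gibbs_density_normalized lexx => /(_ isT).
under eq_integral do rewrite EFinM EFinB.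
rewrite integralZl//; last exact: integrableB.
rewrite integralB// integral_probability_cst.
move: KL0; case: (KL P Q) => [k||//] _; last first.
  rewrite gt0_muley ?lte_fin ?invr_gt0// addye ?leey// gt_eqF//.
  exact: lt_le_trans ltNy0 If0.
have : \int[P]_y (f y)%:E \is a fin_num by exact: integrable_fin_num.
move=> /fineK <-; rewrite -EFinB -!EFinM -EFinD !lee_fin => h.
by rewrite -lerBlDr -(ler_pM2l lambda_gt0) mulrA mulfV ?mul1r ?gt_eqF.
Qed.

(** The logarithm of the Gibbs density is lambda (F - f), so only the
integrability of f under the Gibbs measure matters; it holds because
x exp(- lambda x) <= 1 / lambda. *)
Lemma KL_gibbs P :
  is_density P Q (fun y => expR (lambda * (free_energy Q f - f y))) ->
  \int[P]_y (f y)%:E \is a fin_num /\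
  KL P Q = lambda%:E * ((free_energy Q f)%:E - \int[P]_y (f y)%:E).
Proof.
move=> Pg; set F := free_energy Q f in Pg *.
have If : \int[P]_y (f y)%:E < +oo.
  rewrite (integral_density Pg)//; last exact/measurable_EFinP.
  apply: (@le_lt_trans _ _ (\int[Q]_y (cst (lambda^-1 * expR (lambda * F))%:E y))).
    apply: ge0_le_integral => //.
    - by move=> y _; rewrite -EFinM lee_fin mulr_ge0// expR_ge0.
    - case: Pg => _ mg _; apply/measurable_EFinP; exact: measurable_funM.
    - move=> y _; rewrite -EFinM lee_fin mulrBr expRD mulrCA mulrC ler_pM2r ?expR_gt0//.
      rewrite -(ler_pM2l lambda_gt0) mulfV ?gt_eqF// mulrA.
      rewrite expRN ler_pdivrMr ?expR_gt0// mul1r.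
      by have := expR_ge1Dx (lambda * f y); lra.
  by rewrite integral_probability_cst ltry.
have iff : P.-integrable [set: Y] (EFin \o f).
  apply/integrableP; split; first exact/measurable_EFinP.
  by under eq_integral do rewrite /= ger0_norm//.
have iF : P.-integrable [set: Y] (EFin \o cst F).
  exact: (finite_measure_integrable_cst P F measurableT).
split; first exact: integrable_fin_num.
rewrite (KL_density Pg); under eq_integral do rewrite expRK EFinM EFinB.
rewrite integralZl//; last exact: integrableB.
by rewrite integralB// integral_probability_cst.
Qed.

End fixed_cost.
End free_energy.

(** * Kernels and their free energies *)

Section kdensity.
Context d d' (X : measurableType d) (Y : measurableType d') (R : realType).
Variables (l : R.-pker X ~> Y) (g : X * Y -> R).
Hypotheses (mg : measurable_fun [set: X * Y] g) (g_ge0 : forall w, (0 <= g w)%R).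
Hypothesis g1 : forall x, \int[l x]_y (g (x, y))%:E = 1.

(** The kernel with density g with respect to l.  The proofs are arguments so
that the measure and kernel structures can be inferred from the term. *)
Definition kdensity of measurable_fun [set: X * Y] g &
    (forall w, (0 <= g w)%R) & (forall x, \int[l x]_y (g (x, y))%:E = 1) :=
  fun x A => \int[l x]_(y in A) (g (x, y))%:E.

Local Notation kd := (kdensity mg g_ge0 g1).

Let mgx x A : measurable_fun A (fun y => (g (x, y))%:E).
Proof.
apply: measurable_funTS; apply/measurable_EFinP.
exact: measurableT_comp mg (pair1_measurable x).
Qed.

Let kdensity0 x : kd x set0 = 0. Proof. exact: integral_set0. Qed.

Let kdensity_ge0 x A : 0 <= kd x A.
Proof. by apply: integral_ge0 => y _; rewrite lee_fin. Qed.

Let kdensity_sigma_additive x : semi_sigma_additive (kd x).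
Proof.
move=> /= F mF tF mUF; rewrite /kdensity; apply: cvg_toP.
  apply: ereal_nondecreasing_is_cvgn => m n mn.
  apply: lee_sum_nneg_natr => // k _ _.
  by apply: integral_ge0 => y _; rewrite lee_fin.
by rewrite ge0_integral_bigcup//= => y _; rewrite lee_fin.
Qed.

HB.instance Definition _ x := isMeasure.Build _ _ R (kd x)
  (kdensity0 x) (kdensity_ge0 x) (@kdensity_sigma_additive x).

Definition mkdensity : X -> {measure set Y -> \bar R} := kd.

Let measurable_mkdensity A : measurable A ->
  measurable_fun [set: X] (mkdensity ^~ A).
Proof.
move=> mA.
pose h (w : X * Y) := (g w)%:E * (\1_A w.2)%:E : \bar R.
rewrite (_ : _ ^~ _ = fun x => \int[l x]_y h (x, y)); last first.
  apply/funext => x; rewrite /mkdensity/= /kdensity integral_mkcond.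
  by rewrite epatch_indic.
apply: measurable_fun_integral_finite_kernel => //.
- by move=> w; rewrite /h -EFinM lee_fin mulr_ge0.
- apply: emeasurable_funM; first exact/measurable_EFinP.
  by apply/measurable_EFinP; exact: measurableT_comp.
Qed.

HB.instance Definition _ := isKernel.Build _ _ _ _ _ mkdensity
  measurable_mkdensity.

Let mkdensity_prob x : mkdensity x [set: Y] = 1.
Proof. exact: g1. Qed.

HB.instance Definition _ :=
  Kernel_isProbability.Build _ _ _ _ _ mkdensity mkdensity_prob.

Lemma kernel_density_exists : exists k : R.-pker X ~> Y,
  forall x, is_density (kernel_at k x) (kernel_at l x) (fun y => g (x, y)).
Proof.
exists mkdensity => x; split => //.
exact: measurableT_comp mg (pair1_measurable x).
Qed.

End kdensity.

Section kernel_free_energy.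
Context d d' (X : measurableType d) (Y : measurableType d') (R : realType).
Variable lambda : R.
Hypothesis lambda_gt0 : (0 < lambda)%R.

Lemma condKL_ge0 (k l : R.-pker X ~> Y) x :
  ac_kernel k l -> 0 <= condKL k l x.
Proof. by move=> [kl _]; apply: KL_ge0; exact: kl. Qed.

Variables (l : R.-pker X ~> Y) (f : X * Y -> R).

Definition kernel_free_energy x : R :=
  free_energy lambda (kernel_at l x) (fun y => f (x, y)).

Hypotheses (mf : measurable_fun [set: X * Y] f) (f_ge0 : forall w, (0 <= f w)%R).

Let mfx x : measurable_fun [set: Y] (fun y => f (x, y)).
Proof. exact: measurableT_comp mf (pair1_measurable x). Qed.

Lemma measurable_kernel_free_energy : measurable_fun [set: X] kernel_free_energy.
Proof.
apply: measurable_funM => //; apply: (measurableT_comp (@measurable_ln R)).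
apply: measurableT_comp => //.
apply: (measurable_fun_integral_finite_kernel
  (fun w => (expR (- (lambda * f w)))%:E)).
  by move=> w; rewrite lee_fin expR_ge0.
apply/measurable_EFinP; apply: measurableT_comp => //.
by apply: measurableT_comp => //; exact: measurable_funM.
Qed.

Lemma kernel_free_energy_ge0 x : (0 <= kernel_free_energy x)%R.
Proof. exact: free_energy_ge0. Qed.

Lemma expR_kernel_free_energy x : (expR (- (lambda * kernel_free_energy x)))%:E =
  \int[l x]_y (expR (- (lambda * f (x, y))))%:E.
Proof. by rewrite expR_free_energy. Qed.

Lemma kernel_free_energy_le (k : R.-pker X ~> Y) x : ac_kernel k l ->
  (kernel_free_energy x)%:E <=
  lambda^-1%:E * condKL k l x + \int[k x]_y (f (x, y))%:E.
Proof. by move=> [kl _]; apply: free_energy_le => //; exact: kl. Qed.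

(** The free energy is measurable in x, so the Gibbs densities form a jointly
measurable function and define a kernel.  Its conditional divergence is
lambda (F - int f), an explicit measurable function of x. *)
Lemma gibbs_kernel_exists : exists k : R.-pker X ~> Y, ac_kernel k l /\
  forall x, lambda^-1%:E * condKL k l x + \int[k x]_y (f (x, y))%:E =
            (kernel_free_energy x)%:E.
Proof.
pose g w := expR (lambda * (kernel_free_energy w.1 - f w)).
have mg : measurable_fun [set: X * Y] g.
  apply: measurableT_comp => //; apply: measurable_funM => //.
  apply: measurable_funB => //.
  exact: measurableT_comp measurable_kernel_free_energy measurable_fst.
have g0 w : (0 <= g w)%R by exact: expR_ge0.
have g1 x : \int[l x]_y (g (x, y))%:E = 1.
  by have := gibbs_density_normalized lambda_gt0 (kernel_at l x) (mfx x)
    (fun y => f_ge0 (x, y)).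
have [k kg] := kernel_density_exists mg g0 g1.
have KLk x := KL_gibbs lambda_gt0 (mfx x) (fun y => f_ge0 (x, y)) (kg x).
exists k; split; first split.
- by move=> x; exact: density_dominates (kg x).
- rewrite (_ : condKL _ _ = fun x => lambda%:E *
      ((kernel_free_energy x)%:E - \int[k x]_y (f (x, y))%:E)); last first.
    by apply/funext => x; have [_] := KLk x.
  apply: measurable_funeM; apply: emeasurable_funB.
    by apply/measurable_EFinP; exact: measurable_kernel_free_energy.
  apply: (measurable_fun_integral_finite_kernel (EFin \o f)).
    by move=> w; rewrite lee_fin.
  exact/measurable_EFinP.
- move=> x; have [If] := KLk x; rewrite -/(condKL k l x) => ->.
  rewrite muleA -EFinM mulVf ?gt_eqF// mul1e.
  by rewrite subeK.
Qed.

End kernel_free_energy.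

(** * The recursion for the expected cost *)

Section trajectory_integrals.
Context dX dU (X : measurableType dX) (U : measurableType dU) (R : realType).

Lemma integral_traj_step n (p : R.-pker X ~> U) (q : R.-pker (X * U) ~> X)
    (K : R.-pker X ~> (n.-tuple (X * U) * X)%type) x
    (h : n.+1.-tuple (X * U) * X -> \bar R) :
  (forall w, 0 <= h w) -> measurable_fun [set: _] h ->
  \int[traj_step p q K x]_w h w =
  \int[p x]_u \int[q (x, u)]_y \int[K y]_w h (traj_cons ((x, u), y, w)).
Proof.
move=> h0 mh; rewrite [LHS]integral_kcomp//.
apply: eq_integral => u _; rewrite [LHS]integral_kcomp//.
apply: eq_integral => y _; rewrite [LHS]integral_kcomp//.
apply: eq_integral => w _; rewrite [LHS]integral_dirac// diracT mul1e//.
Qed.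

Variables (T : nat) (lambda : R).
Hypothesis lambda_gt0 : (0 < lambda)%R.
Variables (rho : nat -> R.-pker X ~> U) (iota : nat -> R.-pker (X * U) ~> X).
Variables (c : nat -> X * U -> R) (cT : X -> R).
Hypothesis mc : forall t, (t < T)%N -> measurable_fun [set: X * U] (c t).
Hypothesis c_ge0 : forall t xu, (t < T)%N -> (0 <= c t xu)%R.
Hypotheses (mcT : measurable_fun [set: X] cT) (cT_ge0 : forall x, (0 <= cT x)%R).

Local Notation stage := (stage_cost lambda rho iota c).
Local Notation segment := (segment_cost lambda rho iota c cT).

(** The cost-to-go with the number n of remaining steps as an argument, which
is what inductions run on; [cost_to_go] is the case n = T - t. *)
Definition expected_cost (p : policies X U R) n t x : \bar R :=
  \int[traj_law p.1 p.2 n t x]_w segment p t w.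

Lemma segment_cost_cons p n t xu y (w : n.-tuple (X * U) * X) :
  segment p t (traj_cons (xu, y, w)) = stage p t xu + segment p t.+1 w.
Proof.
rewrite /segment_cost big_ord_recl/= addn0 (tnth_nth xu)/= addeCA.
congr (_ + (_ + _)); apply: eq_bigr => i _.
by rewrite /bump/= add1n addnS -addSn !(tnth_nth xu).
Qed.

Section admissible_policies.
Variables (p : policies X U R) (t0 : nat).
Hypothesis ac1 : forall k, (t0 <= k < T)%N -> ac_kernel (p.1 k) (rho k).
Hypothesis ac2 : forall k, (t0 <= k < T)%N -> ac_kernel (p.2 k) (iota k).

Lemma stage_cost_ge0 k xu : (t0 <= k < T)%N -> 0 <= stage p k xu.
Proof.
move=> kT; have /andP[_ kltT] := kT.
have l0 : 0 <= lambda^-1%:E by rewrite lee_fin invr_ge0 ltW.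
rewrite /stage_cost !adde_ge0 ?mule_ge0 ?lee_fin ?c_ge0//; apply: condKL_ge0.
- exact: ac1.
- exact: ac2.
Qed.

Lemma measurable_stage_cost k : (t0 <= k < T)%N ->
  measurable_fun [set: X * U] (stage p k).
Proof.
move=> kT; have /andP[_ kltT] := kT.
apply: emeasurable_funD; first apply: emeasurable_funD.
- by apply/measurable_EFinP; exact: mc.
- apply: measurable_funeM; have [_ m1] := ac1 kT.
  exact: measurableT_comp m1 measurable_fst.
- by apply: measurable_funeM; have [_ m2] := ac2 kT.
Qed.

Lemma segment_cost_ge0 n t w : (t0 <= t)%N -> (t + n <= T)%N ->
  0 <= @segment_cost _ _ _ _ _ lambda rho iota c cT p n t w.
Proof.
move=> t0t tnT; rewrite adde_ge0 ?lee_fin//.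
apply: sume_ge0 => i _; apply: stage_cost_ge0.
by rewrite (leq_trans t0t) ?leq_addr//= (leq_trans _ tnT)// ltn_add2l.
Qed.

Lemma measurable_segment_cost n t : (t0 <= t)%N -> (t + n <= T)%N ->
  measurable_fun [set: n.-tuple (X * U) * X] (@segment p n t).
Proof.
move=> t0t tnT; apply: emeasurable_funD.
  by apply/measurable_EFinP; exact: measurableT_comp.
apply: emeasurable_sum => i.
have iT : (t0 <= t + i < T)%N.
  by rewrite (leq_trans t0t) ?leq_addr//= (leq_trans _ tnT)// ltn_add2l.
apply: (measurableT_comp (measurable_stage_cost iT)).
exact: (measurableT_comp (measurable_tnth i)).
Qed.

Lemma expected_cost_ge0 n t x : (t0 <= t)%N -> (t + n <= T)%N ->
  0 <= expected_cost p n t x.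
Proof. by move=> *; apply: integral_ge0 => w _; exact: segment_cost_ge0. Qed.

Lemma measurable_expected_cost n t : (t0 <= t)%N -> (t + n <= T)%N ->
  measurable_fun [set: X] (expected_cost p n t).
Proof.
move=> t0t tnT; apply: measurable_fun_integral_kernel.
- by move=> A mA; exact: measurable_kernel.
- by move=> w; exact: segment_cost_ge0.
- exact: measurable_segment_cost.
Qed.

Lemma expected_cost0 t x : expected_cost p 0 t x = (cT x)%:E.
Proof.
rewrite /expected_cost [LHS]integral_dirac// ?diracT ?mul1e.
  by rewrite /segment_cost big_ord0 adde0.
rewrite (_ : segment p t = fun w => (cT w.2)%:E).
  by apply/measurable_EFinP; exact: measurableT_comp.
by apply/funext => w; rewrite /segment_cost big_ord0 adde0.
Qed.

Lemma expected_costS n t x : (t0 <= t)%N -> (t + n.+1 <= T)%N ->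
  expected_cost p n.+1 t x = \int[p.1 t x]_u
    (stage p t (x, u) + \int[p.2 t (x, u)]_y expected_cost p n t.+1 y).
Proof.
move=> t0t tnT.
have tT : (t0 <= t < T)%N.
  by rewrite t0t (leq_trans _ tnT)// addnS ltnS leq_addr.
have t0t1 : (t0 <= t.+1)%N by rewrite ltnW.
have tnT1 : (t.+1 + n <= T)%N by rewrite addSnnS.
rewrite [LHS]integral_traj_step//; last 2 first.
- by move=> w; exact: segment_cost_ge0.
- exact: measurable_segment_cost.
apply: eq_integral => u _; rewrite /expected_cost.
have s0 := stage_cost_ge0 (x, u) tT.
transitivity (\int[p.2 t (x, u)]_y (stage p t (x, u) + expected_cost p n t.+1 y)).
  apply: eq_integral => y _.
  under eq_integral do rewrite segment_cost_cons.
  rewrite ge0_integralD//; last 2 first.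
  - by move=> w _; exact: segment_cost_ge0.
  - exact: measurable_segment_cost.
  by rewrite (integral_probability_cst (kernel_at (traj_law p.1 p.2 n t.+1) y)).
rewrite ge0_integralD//; last 2 first.
- by move=> y _; exact: expected_cost_ge0.
- exact: measurable_expected_cost.
by rewrite (integral_probability_cst (kernel_at (p.2 t) (x, u))).
Qed.

End admissible_policies.

(** * Soft dynamic programming *)

(** The candidate value function at time t with n remaining steps; each of the
two minimizations of a stage is replaced by a free energy. *)
Fixpoint soft_value n t : X -> R :=
  if n is m.+1 then
    kernel_free_energy lambda (rho t) (fun xu => (c t xu +
      kernel_free_energy lambda (iota t) (fun w => soft_value m t.+1 w.2) xu)%R)
  else cT.

(** The state-action value: the transition kernel has been optimized, the
action not yet. *)
Definition soft_qvalue n t (xu : X * U) : R :=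
  (c t xu +
   kernel_free_energy lambda (iota t) (fun w => soft_value n t.+1 w.2) xu)%R.

(** The two properties are proved together, since both are hypotheses of the
measurability and of the nonnegativity of a free energy. *)
Lemma soft_value_meas_ge0 n t : (t + n <= T)%N ->
  measurable_fun [set: X] (soft_value n t) /\ forall x, (0 <= soft_value n t x)%R.
Proof.
elim: n t => [//|n IH] t tnT.
have tT : (t < T)%N by rewrite (leq_trans _ tnT)// addnS ltnS leq_addr.
have [|mv v0] := IH t.+1; first by rewrite addSnnS.
have mv2 : measurable_fun [set: X * U * X] (fun w => soft_value n t.+1 w.2).
  exact: measurableT_comp mv measurable_snd.
have mq : measurable_fun [set: X * U] (soft_qvalue n t).
  by apply: measurable_funD; [exact: mc|exact: measurable_kernel_free_energy].
have q0 xu : (0 <= soft_qvalue n t xu)%R.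
  by rewrite addr_ge0 ?c_ge0//; exact: kernel_free_energy_ge0.
split; first exact: measurable_kernel_free_energy.
by move=> x; exact: kernel_free_energy_ge0.
Qed.
Lemma measurable_soft_value n t : (t + n <= T)%N ->
  measurable_fun [set: X] (soft_value n t).
Proof. by move=> /soft_value_meas_ge0[]. Qed.

Lemma soft_value_ge0 n t x : (t + n <= T)%N -> (0 <= soft_value n t x)%R.
Proof. by move=> /soft_value_meas_ge0[]. Qed.

Section one_step.
Variables (n t : nat).
Hypothesis tnT : (t + n.+1 <= T)%N.

Let tT : (t < T)%N.
Proof. by rewrite (leq_trans _ tnT)// addnS ltnS leq_addr. Qed.

Let t1nT : (t.+1 + n <= T)%N. Proof. by rewrite addSnnS. Qed.

Let mnext : measurable_fun [set: X * U * X] (fun w => soft_value n t.+1 w.2).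
Proof. exact: measurableT_comp (measurable_soft_value t1nT) measurable_snd. Qed.

Let next_ge0 (w : X * U * X) : (0 <= soft_value n t.+1 w.2)%R.
Proof. exact: soft_value_ge0. Qed.

Lemma measurable_soft_qvalue : measurable_fun [set: X * U] (soft_qvalue n t).
Proof.
by apply: measurable_funD; [exact: mc|exact: measurable_kernel_free_energy].
Qed.

Lemma soft_qvalue_ge0 xu : (0 <= soft_qvalue n t xu)%R.
Proof. by rewrite addr_ge0 ?c_ge0//; exact: kernel_free_energy_ge0. Qed.

(** The equation exp(- lambda F(Q,f)) = int exp(- lambda f) dQ, once for the
action and once for the next state; the exponential separates the stage cost
from the future. *)
Lemma linear_bellman_soft_value x :
  (expR (- (lambda * soft_value n.+1 t x)))%:E =
  \int[rho t x]_u ((expR (- (lambda * c t (x, u))))%:E *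
    \int[iota t (x, u)]_y (expR (- (lambda * soft_value n t.+1 y)))%:E).
Proof.
rewrite [LHS](expR_kernel_free_energy lambda_gt0 _
  measurable_soft_qvalue soft_qvalue_ge0).
apply: eq_integral => u _; rewrite /soft_qvalue mulrDr opprD expRD EFinM.
congr (_ * _); exact: (expR_kernel_free_energy lambda_gt0 _ mnext next_ge0).
Qed.

Lemma integral_cst_soft_qvalue (k : R.-pker X ~> U) x (a : \bar R) : 0 <= a ->
  \int[k x]_u (a + (soft_qvalue n t (x, u))%:E) =
  a + \int[k x]_u (soft_qvalue n t (x, u))%:E.
Proof.
move=> a0; rewrite ge0_integralD//; last 2 first.
- by move=> u _; rewrite lee_fin soft_qvalue_ge0.
- apply/measurable_EFinP.
  exact: measurableT_comp measurable_soft_qvalue (pair1_measurable x).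
by rewrite (integral_probability_cst (kernel_at k x)).
Qed.

End one_step.

(** The stage is grouped as the policy divergence, which depends on the state
only, and the transition divergence together with the future cost e: these are
the two pairs to which the variational principle applies. *)
Lemma stage_costDr p t x u (e : \bar R) :
  stage p t (x, u) + e = lambda^-1%:E * condKL (p.1 t) (rho t) x +
    ((c t (x, u))%:E + (lambda^-1%:E * condKL (p.2 t) (iota t) (x, u) + e)).
Proof. by rewrite /stage_cost/= -!addeA addeCA. Qed.

(** The variational inequality for the action bounds [soft_value] by the policy
divergence plus the mean of [soft_qvalue]; under the integral, the inequality
for the next state and the induction hypothesis bound [soft_qvalue]. *)
Lemma soft_value_le_expected_cost (p : policies X U R) t0 n t x :
  (forall k, (t0 <= k < T)%N -> ac_kernel (p.1 k) (rho k)) ->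
  (forall k, (t0 <= k < T)%N -> ac_kernel (p.2 k) (iota k)) ->
  (t0 <= t)%N -> (t + n <= T)%N ->
  (soft_value n t x)%:E <= expected_cost p n t x.
Proof.
move=> ac1 ac2; elim: n t x => [t x _ _|n IH t x t0t tnT].
  by rewrite expected_cost0.
have tT : (t0 <= t < T)%N.
  by rewrite t0t (leq_trans _ tnT)// addnS ltnS leq_addr.
have t0t1 : (t0 <= t.+1)%N by rewrite ltnW.
have tnT1 : (t.+1 + n <= T)%N by rewrite addSnnS.
have l0 : 0 <= lambda^-1%:E by rewrite lee_fin invr_ge0 ltW.
have a0 : 0 <= lambda^-1%:E * condKL (p.1 t) (rho t) x.
  by rewrite mule_ge0// condKL_ge0//; exact: ac1.
have J0 y : 0 <= expected_cost p n t.+1 y by exact: (expected_cost_ge0 ac1 ac2).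
have mJ := measurable_expected_cost ac1 ac2 t0t1 tnT1.
have mq := measurable_soft_qvalue tnT.
have q0 := soft_qvalue_ge0 tnT.
apply: le_trans (kernel_free_energy_le lambda_gt0 mq q0 x (ac1 _ tT)) _.
rewrite -(integral_cst_soft_qvalue tnT)// (expected_costS ac1 ac2)//.
apply: ge0_le_integral => //.
- by move=> u _; rewrite adde_ge0// lee_fin.
- apply: emeasurable_funD => //; apply/measurable_EFinP.
  exact: measurableT_comp mq (pair1_measurable x).
- apply: (@measurableT_comp _ _ _ _ _ _
    (fun xu => stage p t xu + \int[p.2 t xu]_y expected_cost p n t.+1 y)) => //.
  apply: emeasurable_funD; first exact: (measurable_stage_cost ac1 ac2).
  by apply: measurable_fun_integral_kernel => // A mA; exact: measurable_kernel.
- move=> u _; rewrite stage_costDr leeD2l// /soft_qvalue EFinD leeD2l//.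
  have mv := measurable_soft_value tnT1.
  apply: le_trans (kernel_free_energy_le lambda_gt0 _ _ (x, u) (ac2 _ tT)) _.
  + exact: measurableT_comp mv measurable_snd.
  + by move=> w; exact: soft_value_ge0.
  rewrite leeD2l//; apply: ge0_le_integral => //.
  + by move=> y _; rewrite lee_fin soft_value_ge0.
  + exact/measurable_EFinP.
  + by move=> y _; exact: IH.
Qed.

(** Gibbs kernels are chosen stage by stage: those of time t refer to the
[soft_value] of time t+1, which does not involve the chosen policies, so the
choices are independent.  From time T on the baseline serves as a default. *)
Lemma optimal_policies_exist : exists p : policies X U R,
  [/\ forall k, (k < T)%N -> ac_kernel (p.1 k) (rho k),
      forall k, (k < T)%N -> ac_kernel (p.2 k) (iota k) &
      forall n t x, (t + n = T)%N ->
        expected_cost p n t x = (soft_value n t x)%:E].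
Proof.
have /choice[p1 p1P] : forall t, exists k : R.-pker X ~> U, (t < T)%N ->
    ac_kernel k (rho t) /\ forall x, lambda^-1%:E * condKL k (rho t) x +
      \int[k x]_u (soft_qvalue (T - t.+1) t (x, u))%:E =
      (kernel_free_energy lambda (rho t) (soft_qvalue (T - t.+1) t) x)%:E.
  move=> t; have [tT|tT] := ltnP t T; last by exists (rho t).
  have tnT : (t + (T - t.+1).+1 <= T)%N by rewrite subnSK// subnKC// ltnW.
  have [k kP] := gibbs_kernel_exists lambda_gt0 (rho t)
    (measurable_soft_qvalue tnT) (soft_qvalue_ge0 tnT).
  by exists k.
have /choice[p2 p2P] : forall t, exists k : R.-pker (X * U) ~> X, (t < T)%N ->
    ac_kernel k (iota t) /\ forall xu, lambda^-1%:E * condKL k (iota t) xu +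
      \int[k xu]_y (soft_value (T - t.+1) t.+1 y)%:E =
      (kernel_free_energy lambda (iota t)
        (fun w => soft_value (T - t.+1) t.+1 w.2) xu)%:E.
  move=> t; have [tT|tT] := ltnP t T; last by exists (iota t).
  have tnT : (t.+1 + (T - t.+1) <= T)%N by rewrite subnKC.
  have mv : measurable_fun [set: X * U * X]
      (fun w => soft_value (T - t.+1) t.+1 w.2).
    exact: measurableT_comp (measurable_soft_value tnT) measurable_snd.
  have [k kP] := gibbs_kernel_exists lambda_gt0 (iota t) mv
    (fun w => soft_value_ge0 w.2 tnT).
  by exists k.
pose p : policies X U R := (p1, p2).
have ac1 k : (k < T)%N -> ac_kernel (p.1 k) (rho k) by move=> /p1P[].
have ac2 k : (k < T)%N -> ac_kernel (p.2 k) (iota k) by move=> /p2P[].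
exists p; split => //.
elim=> [t x _|n IH t x tnT]; first by rewrite expected_cost0.
have tT : (t < T)%N by rewrite -tnT addnS ltnS leq_addr.
have nE : n = (T - t.+1)%N by rewrite -tnT -addSnnS addKn.
have tnT' : (t + n.+1 <= T)%N by rewrite tnT.
rewrite (@expected_costS p 0)//.
have a0 : 0 <= lambda^-1%:E * condKL (p.1 t) (rho t) x.
  rewrite mule_ge0 ?lee_fin ?invr_ge0 ?(ltW lambda_gt0)// condKL_ge0//.
  exact: ac1.
transitivity (\int[p1 t x]_u (lambda^-1%:E * condKL (p.1 t) (rho t) x +
    (soft_qvalue n t (x, u))%:E)).
  apply: eq_integral => u _; rewrite stage_costDr; congr (_ + _).
  rewrite /soft_qvalue EFinD; congr (_ + _).
  under eq_integral do rewrite IH ?addSnnS//.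
  by rewrite nE; have [_] := p2P _ tT.
rewrite (integral_cst_soft_qvalue tnT')//.
by have [_ /(_ x)] := p1P _ tT; rewrite -nE.
Qed.

Lemma optimal_valueE t x : (t <= T)%N ->
  optimal_value T lambda rho iota c cT t x = (soft_value (T - t) t x)%:E.
Proof.
rewrite leq_eqVlt => /predU1P[->|tT].
  by rewrite /optimal_value ltnn subnn.
rewrite /optimal_value tT; apply/eqP; rewrite eq_le; apply/andP; split.
- have [p [ac1 ac2 pE]] := optimal_policies_exist.
  rewrite -pE ?subnKC 1?ltnW//; apply: ereal_inf_lbound; exists p => //.
  split=> [k /andP[_]|k /andP[_]|]; [exact: ac1|exact: ac2|].
  rewrite [ltLHS](_ : _ = expected_cost p (T - t) t x)//.
  by rewrite pE ?subnKC 1?ltnW// ltry.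
- apply: le_ereal_inf_tmp => _ [p [ac1 ac2 _] <-].
  by apply: (soft_value_le_expected_cost _ ac1 ac2); rewrite ?subnKC// ltnW.
Qed.

End trajectory_integrals.

Theorem mainTheorem5 (R : realType) (dX dU : measure_display)
    (X : measurableType dX) (U : measurableType dU)
    (T : nat) (lambda : R) (lambda_gt0 : (0 < lambda)%R)
    (rho : nat -> R.-pker X ~> U) (iota : nat -> R.-pker (X * U) ~> X)
    (c : nat -> X * U -> R) (cT : X -> R)
    (mc : forall t, (t < T)%N -> measurable_fun [set: X * U] (c t))
    (c_ge0 : forall t xu, (t < T)%N -> (0 <= c t xu)%R)
    (mcT : measurable_fun [set: X] cT) (cT_ge0 : forall x, (0 <= cT x)%R) :
  let V := optimal_value T lambda rho iota c cT in
  let z := fun t x => expeR (- (lambda%:E * V t x)) in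
  let r := fun t xu => expR (- (lambda * c t xu)) in
  (forall t x, (t < T)%N ->
    exists2 p, admissible T lambda rho iota c cT t x p &
               cost_to_go T lambda rho iota c cT p t x = V t x) /\
  (forall t x, (t < T)%N ->
    z t x = \int[rho t x]_u
              ((r t (x, u))%:E * \int[iota t (x, u)]_y z t.+1 y)).
Proof.
move=> V z r.
have VE t x : (t <= T)%N ->
    V t x = (soft_value lambda rho iota c cT (T - t) t x)%:E.
  exact: optimal_valueE.
split=> t x tT.
  have [p [ac1 ac2 pE]] :=
    optimal_policies_exist lambda_gt0 rho iota mc c_ge0 mcT cT_ge0.
  have pVt : cost_to_go T lambda rho iota c cT p t x = V t x.
    by rewrite VE ?(ltnW tT)// -pE ?subnKC// ltnW.
  exists p => //.
  split=> [k /andP[_]|k /andP[_]|]; [exact: ac1|exact: ac2|].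
  by rewrite pVt VE ?ltry// ltnW.
have tnT : (t + (T - t.+1).+1 <= T)%N by rewrite subnSK// subnKC// ltnW.
rewrite /z VE ?(ltnW tT)// -(subnSK tT).
rewrite [LHS](linear_bellman_soft_value lambda_gt0 rho iota mc c_ge0 mcT cT_ge0 tnT).
apply: eq_integral => u _; congr (_ * _).
by apply: eq_integral => y _; rewrite VE.
Qed.
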